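(* Let $N$ be a finitely generated torsion-free nilpotent group of nilpotency class $c$, let $H\le N$ have finite index, and let $\phi:H\to N$ be a homomorphism. Let $\phi_i:H_iN_{i+1}/N_{i+1}\to N_i/N_{i+1}$ ($1\le i\le c$) be the induced morphisms. Then \[R(\phi)=\prod_{i=1}^cR(\phi_i),\] where a product containing a factor $\infty$ is $\infty$.
   Context: Lower central series: $\gamma_1(K)=K$, $\gamma_{i+1}(K)=[K,\gamma_i(K)]$. Isolator: $\sqrt[K]{L}=\{x\in K:\exists m>0,\ x^m\in L\}$. $N_i=\sqrt[N]{\gamma_i(N)}$ and $H_i=\sqrt[H]{\gamma_i(H)}$, with $N_{c+1}=1$. $\phi_i$ is defined by $hN_{i+1}\mapsto\phi(h)N_{i+1}$ for $h\in H_i$; it is a well-defined homomorphism from the finite-index subgroup $H_iN_{i+1}/N_{i+1}$ of the abelian group $N_i/N_{i+1}$ into $N_i/N_{i+1}$. For a group $K$, a finite-index subgroup $L$ and a homomorphism $\phi:L\to K$, $R(\phi)$ is the number (possibly $\infty$) of classes of the relation $\alpha\sim_\phi\beta\iff\exists\gamma\in L:\ \alpha=\gamma\beta\phi(\gamma^{-1})$ on $K$. *)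

(* Defs.v *)
From Stdlib Require Import Arith List ClassicalEpsilon.
Import ListNotations.

Record Group := Grp {
  gT :> Type;
  gmul : gT -> gT -> gT;
  ginv : gT -> gT;
  gone : gT;
  gmulA : forall x y z, gmul x (gmul y z) = gmul (gmul x y) z;
  gmul1 : forall x, gmul gone x = x;
  gmulV : forall x, gmul (ginv x) x = gone }.

Arguments gmul {g}.
Arguments ginv {g}.
Arguments gone {g}.

Section GroupDefs.
Variable G : Group.

Fixpoint gpow (x : G) (n : nat) : G :=
  match n with 0 => gone | S m => gmul x (gpow x m) end.

Definition gcomm (x y : G) : G := gmul (gmul (ginv x) (ginv y)) (gmul x y).

Definition subgroup (P : G -> Prop) : Prop :=
  P gone /\ (forall x y, P x -> P y -> P (gmul x y)) /\ (forall x, P x -> P (ginv x)).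

Definition gen (S : G -> Prop) : G -> Prop :=
  fun x => forall P, subgroup P -> (forall y, S y -> P y) -> P x.

(* lcs K n = gamma_{n+1}(K) *)
Fixpoint lcs (K : G -> Prop) (n : nat) : G -> Prop :=
  match n with
  | 0 => K
  | S m => gen (fun z => exists x y, K x /\ lcs K m y /\ z = gcomm x y)
  end.

(* lower central series, 1-indexed: gamma K 1 = K, gamma K (i+1) = [K, gamma K i] *)
Definition gamma (K : G -> Prop) (i : nat) : G -> Prop := lcs K (pred i).

Definition isolator (K L : G -> Prop) : G -> Prop :=
  fun x => K x /\ exists m, 0 < m /\ L (gpow x m).

Definition setT : G -> Prop := fun _ => True.

Definition Niso (i : nat) : G -> Prop := isolator setT (gamma setT i).
Definition Hiso (H : G -> Prop) (i : nat) : G -> Prop := isolator H (gamma H i).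

Definition finitely_generated : Prop :=
  exists l : list G, forall x, gen (fun y => In y l) x.

Definition torsion_free : Prop :=
  forall (x : G) m, 0 < m -> gpow x m = gone -> x = gone.

Definition trivial_set (P : G -> Prop) : Prop := forall x, P x -> x = gone.

Definition nilpotent_class (c : nat) : Prop :=
  trivial_set (gamma setT (S c)) /\
  forall c', c' < c -> ~ trivial_set (gamma setT (S c')).

Definition finite_index (H : G -> Prop) : Prop :=
  exists l : list G, forall x, exists y h, In y l /\ H h /\ x = gmul y h.

(* phi : H -> N homomorphism (values outside H irrelevant) *)
Definition is_hom_on (H : G -> Prop) (phi : G -> G) : Prop :=
  forall x y, H x -> H y -> phi (gmul x y) = gmul (phi x) (phi y).

(* ---------- counting classes (None = infinitely many) ---------- *)
Definition has_n_classes (D : G -> Prop) (E : G -> G -> Prop) (n : nat) : Prop :=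
  exists l : list G, length l = n /\ (forall x, In x l -> D x) /\
    (forall i j x y, nth_error l i = Some x -> nth_error l j = Some y -> E x y -> i = j) /\
    (forall a, D a -> exists x, In x l /\ E a x).

Definition num_classes (D : G -> Prop) (E : G -> G -> Prop) : option nat :=
  match excluded_middle_informative (exists n, has_n_classes D E n) with
  | left h => Some (proj1_sig (constructive_indefinite_description _ h))
  | right _ => None
  end.

Definition twisted_rel (L : G -> Prop) (phi : G -> G) (a b : G) : Prop :=
  exists g, L g /\ a = gmul (gmul g b) (phi (ginv g)).

Definition reidemeister (L : G -> Prop) (phi : G -> G) : option nat :=
  num_classes setT (twisted_rel L phi).

(* The same relation for the induced map phi_i on the quotient N_i/N_{i+1},
   written on coset representatives: for alpha, beta in N_i,
   alpha N_{i+1} ~ beta N_{i+1} iff exists h in H_i with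
   alpha N_{i+1} = h beta phi(h^-1) N_{i+1}
   (elements of H_i N_{i+1}/N_{i+1} are the cosets h N_{i+1}, h in H_i, and
   phi_i(h N_{i+1}) = phi(h) N_{i+1}). *)
Definition twisted_rel_mod (M L : G -> Prop) (phi : G -> G) (a b : G) : Prop :=
  exists g, L g /\ M (gmul (ginv (gmul (gmul g b) (phi (ginv g)))) a).

Definition reidemeister_induced (H : G -> Prop) (phi : G -> G) (i : nat) : option nat :=
  num_classes (Niso i) (twisted_rel_mod (Niso (S i)) (Hiso H i) phi).

End GroupDefs.

Definition omul (a b : option nat) : option nat :=
  match a, b with Some x, Some y => Some (x * y) | _, _ => None end.

Fixpoint oprod (f : nat -> option nat) (c : nat) : option nat :=
  match c with 0 => Some 1 | S k => omul (oprod f k) (f (S k)) end.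

(* Main.v *)
Require Import Defs.
From Stdlib Require Import Arith List ClassicalEpsilon.
From Stdlib Require Import Lia FinFun FunctionalExtensionality PropExtensionality ProofIrrelevance.

(** For [0 <= k <= c] let [R_k] be the number of classes of [N] under
    [a = h b phi(h)^-1] modulo [N_{k+1}]; then [R_0 = 1] and [R_c = R(phi)], and it is
    enough that [R_k = R_{k-1} R(phi_k)].  If [R_{k-1}] is infinite, so is [R_k].
    Otherwise [R(phi_j)] is finite for [j < k], which, [N_j / N_{j+1}] being torsion-free
    abelian of finite rank, makes [h |-> h phi_j(h)^-1] injective.  Hence an [h] in [H]
    with [h b phi(h)^-1 b^-1] in [N_k] lies in [N_k], and since [N_k / N_{k+1}] is central
    in [N / N_{k+1}], the classes above that of [b] are those of [b z], where [z] runs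
    through the classes of [phi_k].

    The group-theoretic input is that a power of every element of [gamma_i(K)] lies in
    [gamma_i(L)] when [K] is nilpotent and every element of [K] has a power in
    [L gamma_2(K)].  This shows that isolators are subgroups and that
    [H_i] is the intersection of [H] and [N_i]. *)

Declare Scope grp_scope.
Delimit Scope grp_scope with grp.
Local Infix "*" := gmul : grp_scope.
Local Notation "x ^ n" := (gpow _ x n) : grp_scope.
Local Notation "x '^-1'" := (ginv x) (at level 3, left associativity, format "x '^-1'") : grp_scope.
Local Notation "[~ x , y ]" := (gcomm _ x y) (at level 0) : grp_scope.
Local Open Scope grp_scope.

(** * Elementary identities *)

Section Identities.
Variable G : Group.
Implicit Types x y z : G.

Lemma mulVK x y : x^-1 * (x * y) = y.
Proof. now rewrite gmulA, gmulV, gmul1. Qed.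

Lemma mul_cancel_l x y z : x * y = x * z -> y = z.
Proof. intros e. now rewrite <- (mulVK x y), e, mulVK. Qed.

Lemma mulr1 x : x * gone = x.
Proof. apply (mul_cancel_l x^-1). now rewrite mulVK, gmulV. Qed.

Lemma mulrV x : x * x^-1 = gone.
Proof. apply (mul_cancel_l x^-1). now rewrite mulVK, mulr1. Qed.

Lemma mulKV x y : x * (x^-1 * y) = y.
Proof. now rewrite gmulA, mulrV, gmul1. Qed.

Lemma invK x : (x^-1)^-1 = x.
Proof. apply (mul_cancel_l x^-1). now rewrite mulrV, gmulV. Qed.

Lemma inv1 : (gone : G)^-1 = gone.
Proof. apply (mul_cancel_l gone). now rewrite mulrV, gmul1. Qed.

Lemma invM x y : (x * y)^-1 = y^-1 * x^-1.
Proof.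
apply (mul_cancel_l (x * y)).
now rewrite mulrV, <- gmulA, mulKV, mulrV.
Qed.

Lemma mulA_r x y z : (x * y) * z = x * (y * z).
Proof. now rewrite gmulA. Qed.

End Identities.

(* These ten rules are the Knuth-Bendix completion of the group axioms, so rewriting with them
   brings every group word to its reduced form. *)
#[local] Hint Rewrite mulA_r gmul1 mulr1 gmulV mulrV mulVK mulKV invK inv1 invM : grp.

Ltac grp := unfold gcomm in *; autorewrite with grp in *; try easy.

(** * Powers and commutators *)

Section Powers.
Variable G : Group.
Implicit Types x y z : G.

Lemma eq_of_mulV x y : x^-1 * y = gone -> y = x.
Proof. intros e. now rewrite <- (mulKV _ x y), e, mulr1. Qed.

Lemma commute_mul x y z : z * x = x * z -> z * y = y * z -> z * (x * y) = (x * y) * z.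
Proof. intros hx hy. now rewrite gmulA, hx, mulA_r, hy, gmulA. Qed.

Lemma commute_inv x z : z * x = x * z -> z * x^-1 = x^-1 * z.
Proof.
intros hx. apply (mul_cancel_l _ x).
now rewrite gmulA, <- hx, mulA_r, mulrV, mulr1, mulKV.
Qed.

Lemma commute_pow x z n : z * x = x * z -> z * x ^ n = x ^ n * z.
Proof.
intros hx. induction n as [|n IH]; simpl; [grp|].
now apply commute_mul.
Qed.

Lemma powD x m n : x ^ (m + n) = x ^ m * x ^ n.
Proof. induction m as [|m IH]; simpl; [grp|]. now rewrite IH, gmulA. Qed.

Lemma pow_mul_commute x y n : x * y = y * x -> (x * y) ^ n = x ^ n * y ^ n.
Proof.
intros e. induction n as [|n IH]; simpl; [grp|].
rewrite IH, !mulA_r. f_equal. rewrite !gmulA. f_equal.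
now apply commute_pow.
Qed.

Lemma pow1g n : (gone : G) ^ n = gone.
Proof. induction n; simpl; grp. Qed.

Lemma powM x m n : x ^ (m * n) = (x ^ m) ^ n.
Proof.
induction n as [|n IH].
- now rewrite Nat.mul_0_r.
- replace (m * S n)%nat with (m + m * n)%nat by lia. now rewrite powD, IH.
Qed.

Lemma pow_inv x n : (x^-1) ^ n = (x ^ n)^-1.
Proof.
apply (mul_cancel_l _ (x ^ n)).
rewrite mulrV, <- pow_mul_commute by grp. now rewrite mulrV, pow1g.
Qed.

Lemma pow_conj x y n : (x^-1 * y * x) ^ n = x^-1 * y ^ n * x.
Proof.
induction n as [|n IH]; simpl; [grp|]. rewrite IH. grp.
Qed.

Lemma comm_eq1 x y : x * y = y * x <-> [~ x, y] = gone.
Proof.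
split; intros e.
- unfold gcomm. rewrite e. grp.
- unfold gcomm in e. rewrite mulA_r in e.
  apply (mul_cancel_l _ y^-1), (mul_cancel_l _ x^-1). rewrite e. grp.
Qed.

Lemma comm_inv x y : [~ x, y]^-1 = [~ y, x].
Proof. grp. Qed.

Lemma comm_mul_l x x' y :
  [~ x, y] * x' = x' * [~ x, y] -> [~ x * x', y] = [~ x, y] * [~ x', y].
Proof.
intros e. transitivity (x'^-1 * ([~ x, y] * x') * [~ x', y]); [grp|].
rewrite e. grp.
Qed.

Lemma comm_mul_r x y y' :
  [~ x, y] * y' = y' * [~ x, y] -> [~ x, y * y'] = [~ x, y'] * [~ x, y].
Proof.
intros e. transitivity ([~ x, y'] * (y'^-1 * ([~ x, y] * y'))); [grp|].
rewrite e. grp.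
Qed.

Lemma comm_1l x : [~ gone, x] = gone.
Proof. grp. Qed.

Lemma comm_1r x : [~ x, gone] = gone.
Proof. grp. Qed.

Lemma comm_pow_l x y n : [~ x, y] * x = x * [~ x, y] -> [~ x ^ n, y] = [~ x, y] ^ n.
Proof.
intros e. induction n as [|n IH]; simpl; [apply comm_1l|].
rewrite comm_mul_l, IH; [easy|]. now apply commute_pow.
Qed.

Lemma comm_pow_r x y n : [~ x, y] * y = y * [~ x, y] -> [~ x, y ^ n] = [~ x, y] ^ n.
Proof.
intros e. induction n as [|n IH]; simpl; [apply comm_1r|].
rewrite comm_mul_r, IH; [|now apply commute_pow].
symmetry. now apply commute_pow.
Qed.

Lemma comm_inv_l x y : (forall g, [~ x, y] * g = g * [~ x, y]) -> [~ x^-1, y] = [~ x, y]^-1.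
Proof.
intros e. apply (mul_cancel_l _ [~ x, y]).
rewrite <- comm_mul_l by apply e. now rewrite !mulrV, comm_1l.
Qed.

Lemma comm_inv_r x y : (forall g, [~ x, y] * g = g * [~ x, y]) -> [~ x, y^-1] = [~ x, y]^-1.
Proof.
intros e. apply (mul_cancel_l _ [~ x, y]).
rewrite e, <- comm_mul_r by apply e. now rewrite !mulrV, comm_1r.
Qed.

End Powers.

(** * Subgroups and quotients *)

Section Subgroups.
Variable G : Group.
Implicit Types P K M : G -> Prop.

Lemma sub1 P : subgroup G P -> P gone.
Proof. now intros [h _]. Qed.

Lemma subM P x y : subgroup G P -> P x -> P y -> P (x * y).
Proof. intros [_ [h _]]. apply h. Qed.

Lemma subV P x : subgroup G P -> P x -> P x^-1.
Proof. intros [_ [_ h]]. apply h. Qed.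

Lemma subX P x n : subgroup G P -> P x -> P (x ^ n).
Proof.
intros hP hx. induction n as [|n IH]; simpl; [now apply sub1|now apply subM].
Qed.

Lemma subR P x y : subgroup G P -> P x -> P y -> P [~ x, y].
Proof. intros hP hx hy. unfold gcomm. repeat first [apply subM | apply subV | easy]. Qed.

Lemma sub_cancel_l P x y : subgroup G P -> P x -> P (x * y) -> P y.
Proof.
intros hP hx hxy. rewrite <- (mulVK _ x y). apply subM; auto. now apply subV.
Qed.

Lemma setT_subgroup : subgroup G (setT G).
Proof. now repeat split. Qed.

Lemma gen_subgroup (S : G -> Prop) : subgroup G (gen G S).
Proof.
repeat split.
- intros P hP _. now apply sub1.
- intros x y hx hy P hP hS. apply subM; auto; [now apply hx|now apply hy].
- intros x hx P hP hS. apply subV; auto. now apply hx.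
Qed.

Lemma gen_incl (S : G -> Prop) x : S x -> gen G S x.
Proof. intros hx P _ hS. auto. Qed.

End Subgroups.

Ltac sub_step :=
  match goal with
  | |- _ => assumption
  | |- ?P gone => apply (sub1 _ P)
  | |- ?P (gmul _ _) => apply (subM _ P)
  | |- ?P (ginv _) => apply (subV _ P)
  | |- ?P (gpow _ _ _) => apply (subX _ P)
  | |- ?P (gcomm _ _ _) => apply (subR _ P)
  end.

Ltac sub := try solve [ repeat sub_step ].

Definition normal_in {G : Group} (A M : G -> Prop) : Prop :=
  forall x y, A x -> M y -> M (x^-1 * y * x).

(** Any model of [A / M] is allowed. Subgroups being predicates on [G], the projection is a total
    function that is constrained on [A] only. *)
Definition is_quotient {G : Group} (A M : G -> Prop) (Q : Group) (pi : G -> Q) : Prop :=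
  (forall x y, A x -> A y -> pi (x * y) = pi x * pi y) /\
  (forall q, exists x, A x /\ pi x = q) /\
  (forall x y, A x -> A y -> (pi x = pi y <-> M (x^-1 * y))).

(** * Construction of [A / M] *)

Section QuotientConstruction.
Variables (G : Group) (A M : G -> Prop).
Hypotheses (Asub : subgroup G A) (Msub : subgroup G M).
Hypothesis MN : normal_in A M.

(** Two elements of one coset define extensionally equal predicates, so [epsilon] returns the same
    representative for both. *)
Let rep (x : G) : G := epsilon (inhabits gone) (fun y => A y /\ M (x^-1 * y)).

Local Lemma rep_spec x : A x -> A (rep x) /\ M (x^-1 * rep x).
Proof.
intros hx. apply (epsilon_spec (inhabits gone) (fun y => A y /\ M (x^-1 * y))).
exists x. split; auto. rewrite gmulV. now apply sub1.
Qed.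

Local Lemma rep_eq x y : A x -> A y -> (rep x = rep y <-> M (x^-1 * y)).
Proof.
intros hx hy. split; intros h.
- destruct (rep_spec x hx) as [_ h1], (rep_spec y hy) as [_ h2].
  rewrite <- h in h2.
  replace (x^-1 * y) with ((x^-1 * rep x) * (y^-1 * rep x)^-1) by grp.
  apply subM; auto. now apply subV.
- unfold rep. f_equal. apply functional_extensionality. intros z.
  apply propositional_extensionality.
  split; intros [hz h']; split; auto.
  + replace (y^-1 * z) with ((x^-1 * y)^-1 * (x^-1 * z)) by grp.
    apply subM; auto. now apply subV.
  + replace (x^-1 * z) with ((x^-1 * y) * (y^-1 * z)) by grp.
    now apply subM.
Qed.

Local Lemma rep_rep x : A x -> rep (rep x) = rep x.
Proof.
intros hx. destruct (rep_spec x hx) as [h1 h2].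
symmetry. now apply rep_eq.
Qed.

(** A coset is encoded by its chosen representative, that is, by a fixed point of [rep]. *)
Let T := {x : G | A x /\ rep x = x}.

Let cls (x : G) (hx : A x) : T :=
  exist _ (rep x) (conj (proj1 (rep_spec x hx)) (rep_rep x hx)).

Local Lemma T_eq (u v : T) : rep (proj1_sig u) = rep (proj1_sig v) -> u = v.
Proof.
destruct u as [x [h1 h2]], v as [y [h3 h4]]. simpl. intros e.
rewrite h2, h4 in e. subst y. f_equal. apply proof_irrelevance.
Qed.

Local Lemma cls_eq x hx y hy : M (x^-1 * y) -> cls x hx = cls y hy.
Proof.
intros h. apply T_eq. simpl. rewrite !rep_rep; auto. now apply rep_eq.
Qed.

Let mulT (u v : T) : T :=
  cls _ (subM _ _ _ _ Asub (proj1 (proj2_sig u)) (proj1 (proj2_sig v))).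
Let invT (u : T) : T := cls _ (subV _ _ _ Asub (proj1 (proj2_sig u))).
Let oneT : T := cls _ (sub1 _ _ Asub).

Local Lemma rep_mul x y x' y' : A x -> A y -> A x' -> A y' ->
  M (x^-1 * x') -> M (y^-1 * y') -> M ((x * y)^-1 * (x' * y')).
Proof.
intros hx hy hx' hy' h1 h2.
replace ((x * y)^-1 * (x' * y')) with ((y^-1 * (x^-1 * x') * y) * (y^-1 * y')) by grp.
apply subM; auto.
Qed.

Local Lemma M_refl x : M (x^-1 * x).
Proof. rewrite gmulV. now apply sub1. Qed.

Local Lemma M_rep x : A x -> M ((rep x)^-1 * x).
Proof.
intros hx. replace ((rep x)^-1 * x) with ((x^-1 * rep x)^-1) by grp.
apply subV; auto. now apply rep_spec.
Qed.

Lemma quotient_exists : exists (Q : Group) (pi : G -> Q), is_quotient A M Q pi.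
Proof.
assert (hA : forall x y z, mulT x (mulT y z) = mulT (mulT x y) z).
{ intros [x [h1 h2]] [y [h3 h4]] [z [h5 h6]]. apply cls_eq. simpl.
  assert (hxy : A (x * y)) by now apply subM.
  assert (hyz : A (y * z)) by now apply subM.
  destruct (rep_spec _ hxy) as [h7 h8].
  (* Both bracketings are compared with the product [x * y * z] formed without representatives. *)
  replace ((x * rep (y * z))^-1 * (rep (x * y) * z))
    with (((x * rep (y * z))^-1 * (x * (y * z))) * ((x * y * z)^-1 * (rep (x * y) * z))) by grp.
  apply subM; auto.
  - apply rep_mul; auto; [now apply rep_spec|apply M_refl|now apply M_rep].
  - apply rep_mul; auto. apply M_refl. }
assert (h1 : forall x, mulT oneT x = x).
{ intros [x [h1 h2]]. apply T_eq. simpl. rewrite rep_rep by (apply subM; auto; apply rep_spec, sub1, Asub).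
  apply rep_eq; auto; [apply subM; auto; apply rep_spec, sub1, Asub|].
  replace x with (gone * x) at 2 by grp.
  apply rep_mul; auto; [apply rep_spec| | | ]; try now apply sub1.
  - apply M_rep. now apply sub1.
  - apply M_refl. }
assert (hV : forall x, mulT (invT x) x = oneT).
{ intros [x [h1' h2]]. apply cls_eq. simpl.
  replace gone with (x^-1 * x) by apply gmulV.
  assert (A x^-1) by now apply subV.
  apply rep_mul; auto; [now apply rep_spec| |apply M_refl].
  now apply M_rep. }
exists (Grp T mulT invT oneT hA h1 hV).
(* The value [oneT] outside [A] is a default. *)
exists (fun x => match excluded_middle_informative (A x) with
                 | left h => cls x h | right _ => oneT end).
repeat split.
- intros x y hx hy.
  destruct (excluded_middle_informative (A x)); [|easy].
  destruct (excluded_middle_informative (A y)); [|easy].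
  destruct (excluded_middle_informative (A (x * y))) as [h|h]; [|now destruct h; apply subM].
  apply cls_eq. simpl.
  apply rep_mul; auto; now apply rep_spec.
- intros [x [hx h2]]. exists x. split; auto.
  destruct (excluded_middle_informative (A x)); [|easy].
  apply T_eq. simpl. now rewrite rep_rep.
- destruct (excluded_middle_informative (A x)); [|easy].
  destruct (excluded_middle_informative (A y)); [|easy].
  intros e. apply rep_eq; auto. now injection e.
- destruct (excluded_middle_informative (A x)); [|easy].
  destruct (excluded_middle_informative (A y)); [|easy].
  apply cls_eq.
Qed.

End QuotientConstruction.

(** * Calculus in [A / M] *)

Section QuotientTheory.
Variables (G : Group) (A M : G -> Prop) (Q : Group) (pi : G -> Q).
Hypotheses (Asub : subgroup G A) (HQ : is_quotient A M Q pi).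

Lemma quoM x y : A x -> A y -> pi (x * y) = pi x * pi y.
Proof. apply HQ. Qed.

Lemma quo_surj q : exists x, A x /\ pi x = q.
Proof. apply HQ. Qed.

Lemma quo_eq x y : A x -> A y -> (pi x = pi y <-> M (x^-1 * y)).
Proof. apply HQ. Qed.

Lemma quo1 : pi gone = gone.
Proof.
apply (mul_cancel_l _ (pi gone)). rewrite <- quoM by now apply sub1.
now rewrite gmul1, mulr1.
Qed.

Lemma quoV x : A x -> pi x^-1 = (pi x)^-1.
Proof.
intros hx. apply (mul_cancel_l _ (pi x)).
rewrite <- quoM by sub. now rewrite !mulrV, quo1.
Qed.

Lemma quoX x n : A x -> pi (x ^ n) = pi x ^ n.
Proof.
intros hx. induction n as [|n IH]; simpl; [apply quo1|].
now rewrite quoM, IH by sub.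
Qed.

Lemma quoR x y : A x -> A y -> pi [~ x, y] = [~ pi x, pi y].
Proof.
intros hx hy. unfold gcomm.
now rewrite !quoM, !quoV by sub.
Qed.

Lemma quo_ker x : A x -> (pi x = gone <-> M x).
Proof.
intros hx. rewrite <- quo1. split; intros h.
- symmetry in h. apply quo_eq in h; sub. now rewrite inv1, gmul1 in h.
- symmetry. apply quo_eq; [sub|sub|]. now rewrite inv1, gmul1.
Qed.

End QuotientTheory.

(** * Lower central series *)

Section LowerCentralSeries.
Variables (G : Group) (K : G -> Prop).
Hypothesis Ksub : subgroup G K.

Lemma lcs_subgroup n : subgroup G (lcs G K n).
Proof. destruct n; [exact Ksub|apply gen_subgroup]. Qed.

Lemma lcs_comm n x y : K x -> lcs G K n y -> lcs G K (S n) [~ x, y].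
Proof. intros hx hy. apply gen_incl. now exists x, y. Qed.

Lemma lcs_gen_ind n (P : G -> Prop) : subgroup G P ->
  (forall x y, K x -> lcs G K n y -> P [~ x, y]) -> forall z, lcs G K (S n) z -> P z.
Proof. intros hP h z hz. apply hz; auto. intros ? [x [y [hx [hy ->]]]]. auto. Qed.

(** Normality of one term puts the next term inside it, as [[~ x, y]] is a conjugate of [y^-1] times
    [y]. This inclusion in turn gives normality of the next term, as [x^-1 * y * x] is [y] times a
    commutator. Hence one joint induction. *)
Lemma lcs_normal_decr n :
  normal_in K (lcs G K n) /\ forall z, lcs G K (S n) z -> lcs G K n z.
Proof.
assert (h : forall n, normal_in K (lcs G K n) -> forall z, lcs G K (S n) z -> lcs G K n z).
{ intros m hm. apply lcs_gen_ind; [apply lcs_subgroup|]. intros x y hx hy.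
  pose proof (lcs_subgroup m) as hs.
  replace [~ x, y] with ((x^-1 * y^-1 * x) * y) by grp.
  apply subM; auto. apply hm; sub. }
split; [|apply h]; induction n as [|n IH]; intros x y hx hy.
1, 3: simpl in *; sub.
all: pose proof (lcs_subgroup (S n)) as hs;
  replace (x^-1 * y * x) with (y * [~ x, y]^-1) by grp;
  (apply subM; [easy..|]); (apply subV; [easy|]); apply lcs_comm; auto.
Qed.

Lemma lcs_normal n : normal_in K (lcs G K n).
Proof. apply lcs_normal_decr. Qed.

Lemma lcs_decr m n z : m <= n -> lcs G K n z -> lcs G K m z.
Proof. induction 1; auto. intros hz. apply IHle. now apply lcs_normal_decr. Qed.

Lemma lcs_incl n z : lcs G K n z -> K z.
Proof. apply (lcs_decr 0). lia. Qed.

Lemma lcs_quotient n : exists (Q : Group) (pi : G -> Q), is_quotient K (lcs G K n) Q pi.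
Proof.
apply quotient_exists; auto using lcs_normal, lcs_subgroup.
Qed.

Section ModuloLcs.
Variables (n : nat) (Q : Group) (pi : G -> Q).
Hypothesis HQ : is_quotient K (lcs G K (S n)) Q pi.

Lemma lcs_central z q : lcs G K n z -> pi z * q = q * pi z.
Proof.
intros hz. destruct (quo_surj _ _ _ _ _ HQ q) as [x [hx <-]].
assert (hzK : K z) by now apply (lcs_incl n).
symmetry. apply comm_eq1. rewrite <- (quoR _ _ _ _ _ Ksub HQ) by easy.
apply (quo_ker _ _ _ _ _ Ksub HQ); sub. now apply lcs_comm.
Qed.

End ModuloLcs.

(** * The commutator as a bilinear map modulo [lcs G K (S (S n))] *)

Section ModuloLcs2.
Variables (n : nat) (Q : Group) (pi : G -> Q).
Hypothesis HQ : is_quotient K (lcs G K (S (S n))) Q pi.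

Lemma comm_central x y q : K x -> lcs G K n y ->
  [~ pi x, pi y] * q = q * [~ pi x, pi y].
Proof.
intros hx hy. rewrite <- (quoR _ _ _ _ _ Ksub HQ); auto; [|now apply (lcs_incl n)].
apply (lcs_central (S n)); auto. now apply lcs_comm.
Qed.

(* [x |-> [x, y]] is a homomorphism into an abelian group, hence kills commutators. *)
Lemma comm_gamma2 u y : lcs G K 1 u -> lcs G K n y -> [~ pi u, pi y] = gone.
Proof.
intros hu hy. enough (h : K u /\ [~ pi u, pi y] = gone) by apply h.
revert u hu. apply lcs_gen_ind.
- assert (hc : forall x q, K x -> [~ pi x, pi y] * q = q * [~ pi x, pi y])
    by auto using comm_central.
  split; [split; [sub|rewrite (quo1 _ _ _ _ _ Ksub HQ); apply comm_1l]|split].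
  + intros a b [ha ea] [hb eb]. split; [sub|].
    rewrite (quoM _ _ _ _ _ HQ), comm_mul_l, ea, eb by auto. apply gmul1.
  + intros a [ha ea]. split; [sub|].
    rewrite (quoV _ _ _ _ _ Ksub HQ), comm_inv_l, ea by auto. apply inv1.
- simpl. intros a b ha hb. split; [sub|].
  assert (hc : forall x q, K x -> [~ pi x, pi y] * q = q * [~ pi x, pi y])
    by auto using comm_central.
  assert (hM : forall x x', K x -> K x' ->
    [~ pi (x * x'), pi y] = [~ pi x, pi y] * [~ pi x', pi y])
    by (intros; rewrite (quoM _ _ _ _ _ HQ) by easy; now apply comm_mul_l; auto).
  assert (hV : forall x, K x -> [~ pi x^-1, pi y] = [~ pi x, pi y]^-1)
    by (intros; rewrite (quoV _ _ _ _ _ Ksub HQ) by easy; now apply comm_inv_l; auto).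
  unfold gcomm at 2. rewrite !hM, !hV by sub.
  rewrite (hc a [~ pi b, pi y]) by easy.
  rewrite !mulA_r, (mulVK _ [~ pi b, pi y]). apply gmulV.
Qed.

(** Modulo [lcs G K (S (S n))], which [W] contains, the map [x |-> [~ x, y]] is a homomorphism, so
    this is the preimage of a subgroup. With its companion below it reduces statements about
    commutators to generators. *)
Lemma comm_mem_subgroup_l (W : G -> Prop) y : subgroup G W ->
  (forall z, lcs G K (S (S n)) z -> W z) -> lcs G K n y ->
  subgroup G (fun x => K x /\ W [~ x, y]).
Proof.
intros hW hWn hy.
assert (hyK : K y) by now apply (lcs_incl n).
assert (hc : forall x q, K x -> [~ pi x, pi y] * q = q * [~ pi x, pi y])
  by auto using comm_central.
split; [split; [sub|rewrite comm_1l; sub]|split].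
- intros a b [ha wa] [hb wb]. split; [sub|].
  apply (sub_cancel_l _ _ ([~ a, y] * [~ b, y])^-1); sub.
  apply hWn, (quo_eq _ _ _ _ _ HQ); sub.
  rewrite (quoM _ _ _ _ _ HQ), !(quoR _ _ _ _ _ Ksub HQ), (quoM _ _ _ _ _ HQ) by sub.
  symmetry. now apply comm_mul_l; auto.
- intros a [ha wa]. split; [sub|].
  apply (sub_cancel_l _ _ ([~ a, y]^-1)^-1); sub.
  apply hWn, (quo_eq _ _ _ _ _ HQ); sub.
  rewrite (quoV _ _ _ _ _ Ksub HQ), !(quoR _ _ _ _ _ Ksub HQ), (quoV _ _ _ _ _ Ksub HQ) by sub.
  symmetry. now apply comm_inv_l; auto.
Qed.

Lemma comm_mem_subgroup_r (W : G -> Prop) x : subgroup G W ->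
  (forall z, lcs G K (S (S n)) z -> W z) -> K x ->
  subgroup G (fun y => lcs G K n y /\ W [~ x, y]).
Proof.
intros hW hWn hx.
pose proof (lcs_subgroup n) as hn.
assert (hnK : forall y, lcs G K n y -> K y) by apply lcs_incl.
assert (hc : forall y q, lcs G K n y -> [~ pi x, pi y] * q = q * [~ pi x, pi y])
  by auto using comm_central.
split; [split; [sub|rewrite comm_1r; sub]|split].
- intros a b [ha wa] [hb wb]. split; [sub|].
  assert (K a) by auto. assert (K b) by auto.
  apply (sub_cancel_l _ _ ([~ x, b] * [~ x, a])^-1); sub.
  apply hWn, (quo_eq _ _ _ _ _ HQ); sub.
  rewrite (quoM _ _ _ _ _ HQ), !(quoR _ _ _ _ _ Ksub HQ), (quoM _ _ _ _ _ HQ) by sub.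
  symmetry. now apply comm_mul_r; auto.
- intros a [ha wa]. split; [sub|]. assert (K a) by auto.
  apply (sub_cancel_l _ _ ([~ x, a]^-1)^-1); sub.
  apply hWn, (quo_eq _ _ _ _ _ HQ); sub.
  rewrite (quoV _ _ _ _ _ Ksub HQ), !(quoR _ _ _ _ _ Ksub HQ), (quoV _ _ _ _ _ Ksub HQ) by sub.
  symmetry. now apply comm_inv_r; auto.
Qed.

End ModuloLcs2.

End LowerCentralSeries.

Lemma lcs_mono (G : Group) (L K : G -> Prop) n :
  (forall x, L x -> K x) -> forall x, lcs G L n x -> lcs G K n x.
Proof.
intros hLK. induction n as [|n IH]; [exact hLK|]. simpl.
intros x hx. apply hx; [apply gen_subgroup|].
intros ? [a [b [ha [hb ->]]]]. apply gen_incl. exists a, b. auto.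
Qed.

(** * Roots in nilpotent groups *)

(** If [a ^ m] and [b ^ k] agree with elements [l], [l'] of [P] modulo [M], then [(a * b) ^ (m * k)]
    agrees with [l ^ k * l' ^ m], because the images of [A] commute. *)
Lemma root_subgroup (G : Group) (A P B : G -> Prop) (Q : Group) (pi : G -> Q) (M : G -> Prop) :
  subgroup G B -> is_quotient B M Q pi -> subgroup G A -> subgroup G P ->
  (forall x, A x -> B x) -> (forall x, P x -> B x) ->
  (forall x y, A x -> A y -> pi x * pi y = pi y * pi x) ->
  subgroup G (fun z => A z /\ exists m l, 0 < m /\ P l /\ pi (z ^ m) = pi l).
Proof.
intros hB HQ hA hP AB PB hc.
split; [split; [sub|]|split].
- exists 1, gone. split; [lia|]. split; [sub|]. simpl. now rewrite mulr1.
- intros a b [ha [m [l [hm [hl e]]]]] [hb [k [l' [hk [hl' e']]]]].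
  split; [sub|]. exists (m * k)%nat, (l ^ k * l' ^ m).
  split; [nia|]. split; [sub|].
  assert (B a) by auto. assert (B b) by auto. assert (B l) by auto. assert (B l') by auto.
  rewrite (quoX _ _ _ _ _ hB HQ), !(quoM _ _ _ _ _ HQ) by sub.
  rewrite pow_mul_commute by auto.
  rewrite !(quoX _ _ _ _ _ hB HQ), <- e, <- e', !(quoX _ _ _ _ _ hB HQ) by sub.
  rewrite <- !powM. now rewrite (Nat.mul_comm k m).
- intros a [ha [m [l [hm [hl e]]]]]. split; [sub|].
  exists m, l^-1. split; [easy|]. split; [sub|].
  assert (B a) by auto. assert (B l) by auto.
  rewrite pow_inv, !(quoV _ _ _ _ _ hB HQ) by sub. now rewrite e.
Qed.

Section Roots.
Variables (G : Group) (K L : G -> Prop).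
Hypotheses (Ksub : subgroup G K) (Lsub : subgroup G L) (LK : forall x, L x -> K x).

Hypothesis Hroot : forall x, K x -> exists m l u, 0 < m /\ L l /\ lcs G K 1 u /\ x ^ m = l * u.

(** Work modulo [lcs G K (S (S n))], where commutators are bilinear. If [x ^ m = l * u] and
    [y ^ k = l' * v], then [[~ x, y] ^ (m * k)] equals [[~ l * u, l' * v]]; the error [u] drops out
    by [comm_gamma2] and [v] by centrality, which leaves [[~ l, l']]. Such commutators generate, and
    [root_subgroup] handles products. *)
Lemma lcs_root_step n : forall y, lcs G K n y ->
  exists m l u, 0 < m /\ lcs G L n l /\ lcs G K (S n) u /\ y ^ m = l * u.
Proof.
induction n as [|n IH]; [exact Hroot|].
destruct (lcs_quotient G K Ksub (S (S n))) as [Q [pi HQ]].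
assert (hL : subgroup G (lcs G L (S n))) by now apply lcs_subgroup.
assert (hLK : forall m x, lcs G L m x -> lcs G K m x) by (intros; now apply (lcs_mono _ L K)).
assert (hKK : forall m x, lcs G K m x -> K x) by (intros m x; now apply lcs_incl).
assert (h : forall y, lcs G K (S n) y ->
  lcs G K (S n) y /\ exists m l, 0 < m /\ lcs G L (S n) l /\ pi (y ^ m) = pi l).
{ apply lcs_gen_ind.
  - apply (root_subgroup G _ _ K Q pi _ Ksub HQ); eauto.
    + now apply lcs_subgroup.
    + intros x y hx hy. now apply (lcs_central G K Ksub (S n) Q pi HQ).
  - intros x y hx hy. split; [now apply lcs_comm|].
    destruct (Hroot x hx) as [m [l [u [hm [hl [hu e]]]]]].
    destruct (IH y hy) as [k [l' [v [hk [hl' [hv e']]]]]].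
    exists (m * k)%nat, [~ l, l']. split; [nia|]. split; [now apply lcs_comm|].
    assert (K l) by auto. assert (K u) by eauto. assert (K y) by eauto.
    assert (lcs G K n l') by auto. assert (K l') by eauto. assert (K v) by eauto.
    assert (hyk : lcs G K n (y ^ k)) by (apply subX; [now apply lcs_subgroup|easy]).
    rewrite (quoX _ _ _ _ _ Ksub HQ), !(quoR _ _ _ _ _ Ksub HQ) by sub.
    pose proof (comm_central G K Ksub n Q pi HQ) as hc.
    rewrite powM, <- comm_pow_l, <- comm_pow_r.
    2: rewrite <- (quoX _ _ _ _ _ Ksub HQ) by easy; apply hc; sub.
    2: now apply hc.
    rewrite <- !(quoX _ _ _ _ _ Ksub HQ) by sub.
    rewrite e, (quoM _ _ _ _ _ HQ) by easy.
    rewrite comm_mul_l by (apply hc; auto).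
    rewrite (comm_gamma2 G K Ksub n Q pi HQ u) by easy.
    rewrite mulr1, e', (quoM _ _ _ _ _ HQ) by easy.
    rewrite comm_mul_r by (apply hc; auto).
    replace [~ pi l, pi v] with (gone : Q); [apply gmul1|].
    symmetry. apply comm_eq1. symmetry. now apply (lcs_central G K Ksub (S n) Q pi HQ). }
intros y hy. destruct (h y hy) as [_ [m [l [hm [hl e]]]]].
exists m, l, (l^-1 * y ^ m). split; [easy|]. split; [easy|]. split; [|grp].
assert (K l) by eauto. assert (K y) by eauto.
apply (quo_eq _ _ _ _ _ HQ); sub. easy.
Qed.

(** The step is applied again to the error term [u], which is central modulo the next term, so that
    [(l * u) ^ k] becomes [l ^ k * u ^ k] there. The error thus moves as deep as wanted and
    disappears in a nilpotent group. *)
Lemma lcs_root n j : n <= j -> forall y, lcs G K n y ->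
  exists m l u, 0 < m /\ lcs G L n l /\ lcs G K (S j) u /\ y ^ m = l * u.
Proof.
induction 1 as [|j hj IH]; [apply lcs_root_step|]. intros y hy.
destruct (IH y hy) as [m [l [u [hm [hl [hu e]]]]]].
destruct (lcs_root_step (S j) u hu) as [k [l' [u' [hk [hl' [hu' e']]]]]].
destruct (lcs_quotient G K Ksub (S (S j))) as [Q [pi HQ]].
assert (hLn : subgroup G (lcs G L n)) by now apply lcs_subgroup.
assert (hKK : forall m x, lcs G K m x -> K x) by (intros i x; now apply lcs_incl).
assert (lcs G L n l') by (apply (lcs_decr G L Lsub n (S j)); auto).
assert (hLK : forall m x, lcs G L m x -> K x) by (intros i x hx; now apply LK, (lcs_incl _ L Lsub i)).
assert (K l) by eauto. assert (K l') by eauto. assert (K u) by eauto. assert (K u') by eauto.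
assert (K y) by eauto.
exists (m * k)%nat, (l ^ k * l'), ((l ^ k * l')^-1 * y ^ (m * k)).
split; [nia|]. split; [sub|]. split; [|grp].
apply (quo_eq _ _ _ _ _ HQ); sub.
rewrite powM, e, (quoX _ _ _ _ _ Ksub HQ), !(quoM _ _ _ _ _ HQ) by sub.
rewrite pow_mul_commute by (symmetry; now apply (lcs_central G K Ksub (S j) Q pi HQ)).
rewrite <- !(quoX _ _ _ _ _ Ksub HQ) by sub. rewrite e', (quoM _ _ _ _ _ HQ) by sub.
replace (pi u') with (gone : Q); [now rewrite mulr1|].
symmetry. now apply (quo_ker _ _ _ _ _ Ksub HQ).
Qed.

End Roots.

(* Apply [lcs_root] to the subgroup generated by the isolator. *)
Lemma isolator_subgroup (G : Group) (P : G -> Prop) c :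
  subgroup G P -> trivial_set G (lcs G (setT G) c) -> subgroup G (isolator G (setT G) P).
Proof.
intros hP hc.
set (X := isolator G (setT G) P). set (K := gen G X).
assert (hK : subgroup G K) by apply gen_subgroup.
assert (PX : forall x, P x -> X x).
{ intros x hx. split; [easy|]. exists 1. split; [lia|]. simpl. now rewrite mulr1. }
assert (PK : forall x, P x -> K x) by (intros; now apply gen_incl, PX).
enough (h : forall x, K x -> X x).
{ split; [|split].
  - apply PX. sub.
  - intros x y hx hy. apply h. apply subM; auto; now apply gen_incl.
  - intros x hx. apply h. apply subV; auto; now apply gen_incl. }
intros x hx. split; [easy|].
(* In the abelian group [K / gamma_2(K)] the elements with a power in the image of [P] form a
   subgroup; it contains the generators [X], hence everything. *)
assert (hroot : forall x, K x -> exists m l u, 0 < m /\ P l /\ lcs G K 1 u /\ x ^ m = l * u).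
{ clear x hx. destruct (lcs_quotient G K hK 1) as [Q [pi HQ]].
  assert (h : forall x, K x -> K x /\ exists m l, 0 < m /\ P l /\ pi (x ^ m) = pi l).
  { intros x hx. apply hx.
    - apply (root_subgroup G K P K Q pi _ hK HQ); auto.
      intros a b ha _. now apply (lcs_central G K hK 0 Q pi HQ).
    - intros y hy. split; [now apply gen_incl|]. destruct hy as [_ [m [hm hy]]].
      now exists m, (y ^ m). }
  intros x hx. destruct (h x hx) as [_ [m [l [hm [hl e]]]]].
  exists m, l, (l^-1 * x ^ m). repeat split; auto; [|grp].
  assert (K l) by auto. apply (quo_eq _ _ _ _ _ HQ); sub. easy. }
destruct (lcs_root G K P hK hP PK hroot 0 c (Nat.le_0_l c) x hx) as [m [l [u [hm [hl [hu e]]]]]].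
exists m. split; [easy|]. rewrite e.
replace u with (gone : G); [now rewrite mulr1|].
(* The error lies in the term of index [S c] of the series of [K], hence in the trivial term of
   index [c] for the whole group. *)
symmetry. apply hc. apply (lcs_decr G _ (setT_subgroup G) c (S c)); [lia|].
now apply (lcs_mono _ K).
Qed.

(** * The isolated lower central series *)

Section IsolatedSeries.
Variables (N : Group) (c : nat).
Hypothesis Nnil : trivial_set N (lcs N (setT N) c).

Let Tsub : subgroup N (setT N) := setT_subgroup N.

Lemma Niso_subgroup i : subgroup N (Niso N i).
Proof. apply (isolator_subgroup N _ c); auto. now apply lcs_subgroup. Qed.

Lemma Niso_isolated i x m : 0 < m -> Niso N i (x ^ m) -> Niso N i x.
Proof.
intros hm [_ [k [hk h]]]. split; [easy|]. exists (m * k)%nat.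
split; [nia|]. now rewrite powM.
Qed.

Lemma Niso_lcs n x : lcs N (setT N) n x -> Niso N (S n) x.
Proof.
intros hx. split; [easy|]. exists 1. split; [lia|]. simpl. now rewrite mulr1.
Qed.

Lemma Niso_full x : Niso N 1 x.
Proof. now apply Niso_lcs. Qed.

Lemma Niso_decr i j x : i <= j -> Niso N j x -> Niso N i x.
Proof.
intros hij [_ [m [hm h]]]. split; [easy|]. exists m. split; [easy|].
apply (lcs_decr N _ Tsub _ (pred j)); [lia|easy].
Qed.

Lemma Niso_normal i : normal_in (setT N) (Niso N i).
Proof.
intros x y _ [_ [m [hm h]]]. split; [easy|]. exists m. split; [easy|].
rewrite pow_conj. now apply lcs_normal.
Qed.

Lemma Niso_quotient i : exists (Q : Group) (pi : N -> Q), is_quotient (setT N) (Niso N i) Q pi.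
Proof. apply quotient_exists; auto using Niso_subgroup, Niso_normal. Qed.

(* Descending induction on [j] for [x] in [gamma_j]: once [[x, y]] commutes with [y]
   modulo the isolator, [[x, y]^m] is [[x, y^m]]. *)
Lemma Niso_comm i x y : Niso N i y -> Niso N (S i) [~ x, y].
Proof.
destruct i as [|n]; [intros _; apply Niso_full|]. intros hy.
destruct (Niso_quotient (S (S n))) as [Q [pi HQ]].
enough (h : forall d j, j + d = c -> forall x, lcs N (setT N) j x -> Niso N (S (S n)) [~ x, y])
  by now apply (h c 0).
clear x. induction d as [|d IH]; intros j hj x hx.
- replace j with c in hx by lia. rewrite (Nnil x hx), comm_1l.
  apply sub1, Niso_subgroup.
- destruct hy as [_ [m [hm hy]]]. apply (Niso_isolated _ _ m hm).
  assert (hxy : lcs N (setT N) (S j) [~ x, y]).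
  { rewrite <- comm_inv. apply subV; [now apply lcs_subgroup|]. now apply lcs_comm. }
  apply (quo_ker _ _ _ _ _ Tsub HQ); [easy|].
  rewrite (quoX _ _ _ _ _ Tsub HQ), (quoR _ _ _ _ _ Tsub HQ) by easy.
  rewrite <- comm_pow_r.
  2: { rewrite <- (quoR _ _ _ _ _ Tsub HQ) by easy.
       apply comm_eq1. rewrite <- (quoR _ _ _ _ _ Tsub HQ) by easy.
       apply (quo_ker _ _ _ _ _ Tsub HQ); [easy|]. apply (IH (S j)); [lia|easy]. }
  rewrite <- (quoX _ _ _ _ _ Tsub HQ), <- (quoR _ _ _ _ _ Tsub HQ) by easy.
  apply (quo_ker _ _ _ _ _ Tsub HQ); [easy|].
  apply Niso_lcs. now apply lcs_comm.
Qed.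

Lemma Niso_central i (Q : Group) (pi : N -> Q) z q :
  is_quotient (setT N) (Niso N (S i)) Q pi -> Niso N i z -> pi z * q = q * pi z.
Proof.
intros HQ hz. destruct (quo_surj _ _ _ _ _ HQ q) as [x [_ <-]].
symmetry. apply comm_eq1. rewrite <- (quoR _ _ _ _ _ Tsub HQ) by easy.
apply (quo_ker _ _ _ _ _ Tsub HQ); [easy|]. now apply Niso_comm.
Qed.

(* Generation modulo the next term, phrased through the subgroups [W] that contain it. *)
Lemma lcs_finitely_generated n : finitely_generated N ->
  exists l, (forall y, In y l -> lcs N (setT N) n y) /\
    forall W, subgroup N W -> (forall z, lcs N (setT N) (S n) z -> W z) ->
      (forall y, In y l -> W y) -> forall z, lcs N (setT N) n z -> W z.
Proof.
intros [g hg]. induction n as [|n [l [hl IH]]].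
- exists g. split; [easy|]. intros W hW _ hgW z _. now apply hg.
- exists (flat_map (fun x => map (fun y => [~ x, y]) l) g). split.
  + intros z hz. apply in_flat_map in hz. destruct hz as [x [_ hz]].
    apply in_map_iff in hz. destruct hz as [y [<- hy]]. apply lcs_comm; auto. easy.
  + intros W hW hWn hlW.
    destruct (lcs_quotient N _ Tsub (S (S n))) as [Q [pi HQ]].
    (* Linearity is used twice: first in [y] with [x] a fixed generator of [N], then in [x] with [y]
       arbitrary. *)
    assert (hx : forall x y, In x g -> lcs N (setT N) n y -> W [~ x, y]).
    { intros x y hx hy.
      enough (h : lcs N (setT N) n y /\ W [~ x, y]) by apply h.
      revert y hy. apply IH.
      - apply (comm_mem_subgroup_r N _ Tsub n Q pi HQ); easy.
      - intros z hz. split; [now apply (lcs_decr N _ Tsub n (S n)); [lia|]|].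
        apply hWn. now apply lcs_comm.
      - intros y hy. split; [auto|]. apply hlW, in_flat_map. exists x.
        split; [easy|]. now apply in_map. }
    apply lcs_gen_ind; [easy|]. intros x y _ hy.
    enough (h : setT N x /\ W [~ x, y]) by apply h.
    apply (hg x); [now apply (comm_mem_subgroup_l N _ Tsub n Q pi HQ)|].
    intros z hz. split; [easy|]. now apply hx.
Qed.

End IsolatedSeries.

(* Pigeonhole on the exponents. *)
Lemma power_mem_of_cosets (G : Group) (P : G -> Prop) (l : list G) x : subgroup G P ->
  (forall n, exists y h, In y l /\ P h /\ x ^ n = y * h) -> exists m, 0 < m /\ P (x ^ m).
Proof.
intros hP hl.
destruct (choice (fun n y => In y l /\ exists h, P h /\ x ^ n = y * h)) as [f hf].
{ intros n. destruct (hl n) as [y [h [h1 [h2 h3]]]]. exists y. eauto. }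
destruct (classic (exists i j, i < j /\ f i = f j)) as [[i [j [hij e]]]|hn].
- exists (j - i). split; [lia|].
  destruct (hf i) as [_ [h [hh e1]]], (hf j) as [_ [h' [hh' e2]]].
  replace (x ^ (j - i)) with (h^-1 * h'); [sub|].
  apply (mul_cancel_l _ (x ^ i)). rewrite <- powD.
  replace (i + (j - i))%nat with j by lia. rewrite e1, e2, e. grp.
- exfalso.
  assert (hinj : NoDup (map f (seq 0 (S (length l))))).
  { apply Injective_map_NoDup; [|apply seq_NoDup].
    intros i j e. destruct (Nat.lt_trichotomy i j) as [h|[h|h]]; auto;
    exfalso; apply hn; [exists i, j|exists j, i]; auto. }
  apply NoDup_incl_length with (l' := l) in hinj.
  + rewrite length_map, length_seq in hinj. lia.
  + intros y hy. apply in_map_iff in hy. destruct hy as [n [<- _]]. apply hf.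
Qed.

(** * Finite rank *)

Section FiniteRank.
Variable Q : Group.
Hypothesis Qc : forall x y : Q, x * y = y * x.

Definition isolated (S : Q -> Prop) : Prop :=
  subgroup Q S /\ forall x m, 0 < m -> S (x ^ m) -> S x.

(** The smallest isolated subgroup containing [S] and [l]. It plays the role of the linear span in
    the rationalisation of the abelian group, and the lemmas below are Steinitz exchange for it. *)
Definition closure (S : Q -> Prop) (l : list Q) : Q -> Prop :=
  fun a => forall K, isolated K -> (forall x, S x -> K x) -> (forall x, In x l -> K x) -> K a.

Lemma closure_isolated S l : isolated (closure S l).
Proof.
split; [split; [|split]|].
- intros K [hK _] _ _. sub.
- intros x y hx hy K hK hS hl. apply subM; [apply hK|now apply hx|now apply hy].
- intros x hx K hK hS hl. apply subV; [apply hK|now apply hx].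
- intros x m hm hx K hK hS hl. apply (proj2 hK x m hm). now apply hx.
Qed.

Lemma mulACA (a b x y : Q) : (a * b) * (x * y) = (a * x) * (b * y).
Proof. rewrite !mulA_r. f_equal. rewrite !gmulA. f_equal. apply Qc. Qed.

(** A power of [y] is a power of [x] times an element of [T]. The exponent of [x] cannot vanish,
    since [T] is isolated and omits [y], so the relation can be solved for a power of [x]. *)
Lemma exchange T x y : isolated T -> ~ T y ->
  (forall K, isolated K -> (forall z, T z -> K z) -> K x -> K y) ->
  forall K, isolated K -> (forall z, T z -> K z) -> K y -> K x.
Proof.
intros [hT hTi] hy h.
(* The pair [p], [q] stands for the integer exponent [q - p], as [gpow] takes natural exponents
   only. The elements [a] satisfying such a relation form an isolated subgroup containing [T] and
   [x]. *)
assert (he : exists m p q s, 0 < m /\ T s /\ y ^ m * x ^ p = x ^ q * s).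
{ apply (h (fun a => exists m p q s, 0 < m /\ T s /\ a ^ m * x ^ p = x ^ q * s)).
  - split; [split; [|split]|].
    + exists 1, 0, 0, gone. split; [lia|]. split; [sub|]. simpl. grp.
    + intros a b [m [p [q [s [hm [hs e]]]]]] [m' [p' [q' [s' [hm' [hs' e']]]]]].
      exists (m * m')%nat, (p * m' + p' * m)%nat, (q * m' + q' * m)%nat, (s ^ m' * s' ^ m).
      split; [nia|]. split; [sub|].
      rewrite pow_mul_commute by apply Qc. rewrite !powD, (mulACA _ _ (x ^ _)).
      rewrite (mulACA (x ^ (q * m'))).
      rewrite (Nat.mul_comm m m') at 2. rewrite !powM.
      rewrite <- !pow_mul_commute by apply Qc. now rewrite e, e'.
    + intros a [m [p [q [s [hm [hs e]]]]]].
      exists m, q, p, s^-1. split; [easy|]. split; [sub|].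
      rewrite pow_inv. apply (mul_cancel_l _ (a ^ m)). rewrite mulKV.
      rewrite gmulA, e. grp.
    + intros a k hk [m [p [q [s [hm [hs e]]]]]].
      exists (k * m)%nat, p, q, s. split; [nia|]. split; [easy|]. now rewrite powM.
  - intros z hz. exists 1, 0, 0, z. split; [lia|]. split; [easy|]. simpl. grp.
  - exists 1, 0, 1, gone. split; [lia|]. split; [sub|]. simpl. grp. }
destruct he as [m [p [q [s [hm [hs e]]]]]].
intros K [hK hKi] hTK hyK.
assert (K s) by auto.
destruct (Nat.lt_trichotomy p q) as [hpq|[hpq|hpq]].
- apply (hKi x (q - p)); [lia|].
  replace (x ^ (q - p)) with (y ^ m * s^-1); [sub|].
  replace q with (p + (q - p))%nat in e by lia. rewrite powD in e.
  apply (mul_cancel_l _ (x ^ p)). rewrite gmulA, (Qc (x ^ p) (y ^ m)), e.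
  grp.
- exfalso. apply hy, (hTi y m hm). subst q. rewrite Qc in e.
  now apply mul_cancel_l in e; rewrite e.
- apply (hKi x (p - q)); [lia|].
  replace (x ^ (p - q)) with ((y ^ m)^-1 * s); [sub|].
  replace p with (q + (p - q))%nat in e by lia. rewrite powD in e.
  apply (mul_cancel_l _ (x ^ q)), (mul_cancel_l _ (y ^ m)). rewrite e.
  rewrite (gmulA _ (x ^ q)), (Qc (x ^ q)). grp.
Qed.

(** Drop entries from the front until [y] leaves the closure; the entry whose removal causes this
    can be exchanged for [y]. *)
Lemma exchange_list l : forall S y, isolated S -> ~ S y -> closure S l y ->
  exists l1 x l2, l = l1 ++ x :: l2 /\
    forall K, isolated K -> (forall z, S z -> K z) -> K y -> (forall z, In z l2 -> K z) -> K x.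
Proof.
induction l as [|x l IH]; intros S y hS hy hcl.
- exfalso. now apply hy, hcl.
- destruct (classic (closure S l y)) as [h|h].
  + destruct (IH S y hS hy h) as [l1 [x' [l2 [-> hx']]]]. now exists (x :: l1), x', l2.
  + exists nil, x, l. split; [easy|]. intros K hK hSK hyK hl.
    apply (exchange (closure S l) x y); auto using closure_isolated.
    * intros J hJ hcJ hx. apply hcl; auto.
      -- intros z hz. apply hcJ. intros J' _ hJ' _. auto.
      -- intros z [<-|hz]; auto. apply hcJ. intros J' _ _ hJ'. auto.
    * intros z hz. now apply hz.
Qed.

(** Each strict inclusion makes one entry of the spanning list redundant over the next term of the
    chain, so the length of the list bounds the number of strict steps. *)
Lemma no_infinite_chain n : forall l (K : nat -> Q -> Prop), length l = n ->
  (forall a, closure (K 0) l a) -> (forall i, isolated (K i)) ->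
  (forall i x, K i x -> K (S i) x) -> (forall i, exists x, K (S i) x /\ ~ K i x) -> False.
Proof.
induction n as [|n IH]; intros l K hl hcl hK hinc hstr;
  destruct (hstr 0) as [y [h1 h0]];
  destruct (exchange_list l (K 0) y (hK 0) h0 (hcl y)) as [l1 [x [l2 [-> hx]]]];
  rewrite length_app in hl; simpl in hl; [lia|].
apply (IH (l1 ++ l2) (fun i => K (S i))); auto.
- rewrite length_app. lia.
- intros a J hJ hKJ hlJ.
  assert (hJx : J x).
  { apply hx; auto. intros z hz. apply hlJ, in_or_app. auto. }
  apply hcl; auto. intros z hz. apply in_app_or in hz.
  destruct hz as [hz|[<-|hz]]; auto; apply hlJ, in_or_app; auto.
Qed.

(* [R] is a partial endomorphism; the iterated preimages of [1] give the chain. *)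
Lemma partial_endo_injective (l : list Q) (R : Q -> Q -> Prop) :
  torsion_free Q -> (forall K, isolated K -> (forall x, In x l -> K x) -> forall a, K a) ->
  R gone gone ->
  (forall x y x' y', R x y -> R x' y' -> R (x * x') (y * y')) ->
  (forall x y, R x y -> R x^-1 y^-1) ->
  (forall y, R gone y -> y = gone) ->
  (forall y, exists m x, 0 < m /\ R x (y ^ m)) ->
  forall x, R x gone -> x = gone.
Proof.
intros htf hl R1 RM RV Rfun Rsurj x0 hx0.
destruct (classic (x0 = gone)) as [|hne]; [easy|exfalso].
assert (RX : forall x y m, R x y -> R (x ^ m) (y ^ m)).
{ intros x y m h. induction m; simpl; auto. }
assert (Rinj : forall x y y', R x y -> R x y' -> y = y').
{ intros x y y' h h'. symmetry. apply eq_of_mulV. apply Rfun.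
  rewrite <- (gmulV _ x). auto. }
(* These are the kernels of the iterates of [R]. The exponent [m] makes them isolated and allows for
   [R] being defined on part of [Q] only. *)
set (K := fix K (i : nat) : Q -> Prop := match i with
  | 0 => fun a => a = gone
  | S i => fun a => exists m b, 0 < m /\ R (a ^ m) b /\ K i b end).
assert (hK : forall i, isolated (K i)).
{ induction i as [|i [IH IHi]]; simpl.
  - split; [split; [easy|split]|exact htf].
    + intros x y -> ->. grp.
    + intros x ->. grp.
  - split; [split; [|split]|].
    + exists 1, gone. split; [lia|]. rewrite pow1g. split; [easy|sub].
    + intros x y [m [b [hm [hR hb]]]] [m' [b' [hm' [hR' hb']]]].
      exists (m * m')%nat, (b ^ m' * b' ^ m). split; [nia|]. split; [|sub].
      rewrite pow_mul_commute by apply Qc. apply RM.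
      * rewrite powM. auto.
      * rewrite Nat.mul_comm, powM. auto.
    + intros x [m [b [hm [hR hb]]]]. exists m, b^-1. split; [easy|].
      rewrite pow_inv. split; [auto|sub].
    + intros x k hk [m [b [hm [hR hb]]]]. exists (k * m)%nat, b. split; [nia|].
      now rewrite powM. }
apply (no_infinite_chain (length l) l K eq_refl); auto.
- intros a J hJ _ hlJ. now apply (hl J).
- induction i as [|i IH]; intros x; simpl.
  + intros ->. exists 1, gone. split; [lia|]. rewrite pow1g. auto.
  + intros [m [b [hm [hR hb]]]]. exists m, b. split; [easy|]. split; [easy|]. now apply IH.
- induction i as [|i [x [hx hnx]]].
  + exists x0. split; [|easy]. exists 1, gone. split; [lia|]. simpl. now rewrite mulr1.
  (* A preimage [z] of a power of [x] enters the chain one step later than [x]: if it entered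
     together with [x], then [Rinj] would put a power of [x], and so [x], into [K i]. *)
  + destruct (Rsurj x) as [m [z [hm hz]]]. exists z. split.
    * exists 1, (x ^ m). split; [lia|]. simpl gpow. rewrite mulr1. split; [easy|].
      apply subX; [apply hK|easy].
    * intros [k [b [hk [hR hb]]]]. apply hnx.
      apply (proj2 (hK i) x (m * k)%nat); [nia|]. rewrite powM.
      now rewrite (Rinj (z ^ k) _ b); auto.
Qed.

End FiniteRank.

(** * Counting classes *)

Section Counting.
Variable G : Group.
Implicit Types (D : G -> Prop) (E F r : G -> G -> Prop) (l : list G).

Definition equiv_on D E : Prop :=
  (forall x, D x -> E x x) /\
  (forall x y, D x -> D y -> E x y -> E y x) /\
  (forall x y z, D x -> D y -> D z -> E x y -> E y z -> E x z).

Definition separated E l : Prop :=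
  forall i j x y, nth_error l i = Some x -> nth_error l j = Some y -> E x y -> i = j.

Lemma separated_cons E x l :
  separated E (x :: l) <-> separated E l /\ forall y, In y l -> ~ E x y /\ ~ E y x.
Proof.
split.
- intros h. split.
  + intros i j a b ha hb hab. now specialize (h (S i) (S j) a b ha hb hab) as [= ->].
  + intros y hy. apply In_nth_error in hy. destruct hy as [n hn]. split; intros e.
    * now specialize (h 0 (S n) x y eq_refl hn e).
    * now specialize (h (S n) 0 y x hn eq_refl e).
- intros [h hx] [|i] [|j] a b; simpl; intros ha hb hab; auto.
  + injection ha as ->. apply nth_error_In in hb. now destruct (hx b hb).
  + injection hb as ->. apply nth_error_In in ha. now destruct (hx a ha).
  + f_equal. eauto.
Qed.

Lemma separated_nil E : separated E nil.
Proof. intros [|i] j x y hx; discriminate. Qed.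

Lemma separated_app E l l' : separated E l -> separated E l' ->
  (forall x y, In x l -> In y l' -> ~ E x y /\ ~ E y x) -> separated E (l ++ l').
Proof.
induction l as [|x l IH]; simpl; auto. intros hl hl' h.
apply separated_cons in hl. destruct hl as [hl hx]. apply separated_cons. split; auto.
intros y hy. apply in_app_or in hy. destruct hy; auto.
Qed.

(** Pigeonhole for a relation [r] that is injective up to [E]: a partner of the head of [l] is no
    partner of any later entry, so it can be deleted from [l']. *)
Lemma separated_length E r l : separated E l -> forall l',
  (forall x, In x l -> exists y, In y l' /\ r x y) ->
  (forall x x' y, In x l -> In x' l -> r x y -> r x' y -> E x x') -> length l <= length l'.
Proof.
induction l as [|x l IH]; intros hl l' hc hr; simpl; [lia|].
apply separated_cons in hl. destruct hl as [hl hx].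
destruct (hc x) as [y [hy hxy]]; [now left|].
apply in_split in hy. destruct hy as [l1 [l2 ->]].
assert (h : length l <= length (l1 ++ l2)).
{ apply IH; auto; [|intros a b z ha hb; apply hr; now right].
  intros a ha. destruct (hc a) as [b [hb hab]]; [now right|]. exists b. split; auto.
  apply in_app_or in hb. apply in_or_app. destruct hb as [hb|[<-|hb]]; auto.
  exfalso. apply (proj1 (hx a ha)). apply (hr x a y); simpl; auto. }
rewrite length_app in *. simpl. lia.
Qed.

Lemma has_n_classes_le D E m n : equiv_on D E ->
  has_n_classes G D E m -> has_n_classes G D E n -> m <= n.
Proof.
intros [_ [hs ht]] [l [<- [hl [hsep _]]]] [l' [<- [hl' [_ hc']]]].
apply (separated_length E (fun x y => In y l' /\ E x y) l hsep).
- intros x hx. destruct (hc' x) as [y [hy hxy]]; auto. eauto.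
- intros x x' y hx hx' [hy e] [_ e']. apply (ht x y x'); auto.
Qed.

Lemma num_classes_some D E n : equiv_on D E ->
  (num_classes G D E = Some n <-> has_n_classes G D E n).
Proof.
intros hE. unfold num_classes.
destruct (excluded_middle_informative _) as [h|h].
- destruct (constructive_indefinite_description _ h) as [m hm]. simpl.
  split; [now intros [= <-]|]. intros hn. f_equal.
  apply Nat.le_antisymm; eapply has_n_classes_le; eauto.
- split; [easy|]. intros hn. destruct h. eauto.
Qed.

Lemma num_classes_none D E : num_classes G D E = None <-> ~ exists n, has_n_classes G D E n.
Proof.
unfold num_classes. destruct (excluded_middle_informative _); easy.
Qed.

(** The entries of [l] act as labels and may lie outside [D]. Running through them, an element of
    [D] carrying the label is added only when it is inequivalent to all those chosen before. *)
Lemma finite_classes D E r l : equiv_on D E ->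
  (forall a, D a -> exists x, In x l /\ r a x) ->
  (forall a b x, D a -> D b -> r a x -> r b x -> E a b) -> exists n, has_n_classes G D E n.
Proof.
intros [hrf [hs ht]] hc hr.
enough (h : exists l', (forall x, In x l' -> D x) /\ separated E l' /\
  forall a x, In x l -> D a -> r a x -> exists b, In b l' /\ E a b).
{ destruct h as [l' [h1 [h2 h3]]]. exists (length l'), l'. repeat split; auto.
  intros a ha. destruct (hc a ha) as [x [hx hax]]. eauto. }
clear hc. induction l as [|x l [l' [h1 [h2 h3]]]].
- exists nil. split; [easy|]. split; [apply separated_nil|easy].
- destruct (classic (exists a, D a /\ r a x /\ forall b, In b l' -> ~ E a b))
    as [[a [ha [hax hn]]]|hn].
  + exists (a :: l'). split; [|split].
    * intros b [<-|hb]; auto.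
    * apply separated_cons. split; auto. intros b hb. split; auto.
      intros e. apply (hn b hb). auto.
    * intros b y [<-|hy] hb e; [exists a; simpl; eauto|].
      destruct (h3 b y hy hb e) as [z [hz hbz]]. exists z. simpl. auto.
  + exists l'. split; [auto|]. split; [auto|].
    intros a y [<-|hy] ha e; [|eauto].
    apply NNPP. intros hna. apply hn. exists a. repeat split; auto.
    intros b hb hab. apply hna. eauto.
Qed.

Lemma num_classes_finer_none E F : equiv_on (setT G) E -> equiv_on (setT G) F ->
  (forall x y, E x y -> F x y) ->
  num_classes G (setT G) F = None -> num_classes G (setT G) E = None.
Proof.
intros hE hF hEF hn. apply num_classes_none. apply num_classes_none in hn.
intros [n [l [_ [_ [_ hc]]]]]. apply hn.
apply (finite_classes _ F E l hF); auto.
intros a b x _ _ ha hb. destruct hF as [_ [hs ht]].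
apply (ht a x b); auto; try easy. apply hs; auto; easy.
Qed.

(** For every [b], the map [z |-> t b z] identifies the classes of [E'] on [D'] with the [E]-classes
    inside the [F]-class of [b]. All fibres therefore have the same size, and representatives are
    the [t b z] for representatives [b] and [z]. *)
Lemma num_classes_fibration D' E E' F (t : G -> G -> G) n :
  equiv_on (setT G) E -> equiv_on (setT G) F -> equiv_on D' E' ->
  (forall x y, E x y -> F x y) ->
  (forall b z, D' z -> F (t b z) b) ->
  (forall a b, F a b -> exists z, D' z /\ E a (t b z)) ->
  (forall b z z', D' z -> D' z' -> (E (t b z) (t b z') <-> E' z z')) ->
  num_classes G (setT G) F = Some n ->
  num_classes G (setT G) E = omul (Some n) (num_classes G D' E').
Proof.
intros hE hF hE' hEF htF hcov hfib hn.
apply num_classes_some in hn; auto. destruct hn as [l [hln [_ [hsep hcl]]]].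
assert (Es : forall x y, E x y -> E y x) by (intros; now apply hE).
assert (Et : forall x y z, E x y -> E y z -> E x z)
  by (intros x y z; now apply (proj2 (proj2 hE))).
assert (Fs : forall x y, F x y -> F y x) by (intros; now apply hF).
assert (Ft : forall x y z, F x y -> F y z -> F x z)
  by (intros x y z; now apply (proj2 (proj2 hF))).
destruct (num_classes G D' E') as [m|] eqn:hm; simpl.
- apply num_classes_some in hm; auto. destruct hm as [l' [hlm [hl' [hsep' hcl']]]].
  apply num_classes_some; auto.
  exists (flat_map (fun b => map (t b) l') l). split; [|split; [|split]].
  + subst n m. clear. induction l as [|b l IH]; simpl; auto.
    rewrite length_app, length_map. now rewrite IH.
  + easy.
  + clear hln hcl. change (separated E (flat_map (fun b => map (t b) l') l)).
    change (separated F l) in hsep. change (separated E' l') in hsep'.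
    induction l as [|b l IH]; simpl; [apply separated_nil|].
    apply separated_cons in hsep. destruct hsep as [hsep hb].
    apply separated_app; auto.
    * intros i j x y hx hy e. rewrite nth_error_map in hx, hy.
      destruct (nth_error l' i) as [z|] eqn:hi; [|easy]. injection hx as <-.
      destruct (nth_error l' j) as [z'|] eqn:hj; [|easy]. injection hy as <-.
      apply (hsep' i j z z' hi hj), (hfib b); auto; apply hl'; eapply nth_error_In; eauto.
    * intros x y hx hy. apply in_map_iff in hx. destruct hx as [z [<- hz]].
      apply in_flat_map in hy. destruct hy as [b' [hb' hy]].
      apply in_map_iff in hy. destruct hy as [z' [<- hz']].
      assert (F (t b z) b) by auto. assert (F (t b' z') b') by auto.
      assert (hn : ~ F b b') by now apply hb.
      split; intros e; apply hn; apply hEF in e; eauto.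
  + intros a _. destruct (hcl a) as [b [hb hab]]; [easy|].
    destruct (hcov a b hab) as [z [hz haz]].
    destruct (hcl' z hz) as [z' [hz' hzz']]. exists (t b z'). split.
    * apply in_flat_map. exists b. split; auto. now apply in_map.
    * apply (Et _ (t b z)); auto. apply hfib; auto.
- apply num_classes_none. apply num_classes_none in hm.
  intros [k [L [_ [_ [_ hL]]]]]. apply hm.
  (* One fibre is enough here: finitely many [E]-classes would label the elements of [D'] through
     the fibre over [gone]. *)
  apply (finite_classes D' E' (fun z x => E (t gone z) x) L hE').
  + intros z _. now apply hL.
  + intros z z' x hz hz' e e'. apply (hfib gone); eauto.
Qed.

End Counting.

Lemma oprod_some f k n : oprod f k = Some n -> forall j, j < k -> exists r, f (S j) = Some r.
Proof.
revert n. induction k as [|k IH]; simpl; intros n e j hj; [lia|].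
destruct (oprod f k) as [p|]; [|easy]. destruct (f (S k)) as [r|] eqn:er; [|easy].
destruct (Nat.eq_dec j k) as [->|hne]; [eauto|]. apply (IH p); auto. lia.
Qed.

(** * Twisted conjugacy along the isolated series *)

Section Reidemeister.
Variables (N : Group) (c : nat) (H : N -> Prop) (phi : N -> N).
Hypotheses (Nfg : finitely_generated N) (Ntf : torsion_free N).
Hypothesis Nnil : trivial_set N (lcs N (setT N) c).
Hypotheses (Hsub : subgroup N H) (Hfi : finite_index N H) (Hphi : is_hom_on N H phi).

Let Tsub : subgroup N (setT N) := setT_subgroup N.

Lemma phi1 : phi gone = gone.
Proof.
apply (mul_cancel_l _ (phi gone)). rewrite <- Hphi by sub. now rewrite gmul1, mulr1.
Qed.

Lemma phiV x : H x -> phi x^-1 = (phi x)^-1.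
Proof.
intros hx. apply (mul_cancel_l _ (phi x)). rewrite <- Hphi by sub.
now rewrite !mulrV, phi1.
Qed.

Lemma phiX x n : H x -> phi (x ^ n) = phi x ^ n.
Proof.
intros hx. induction n as [|n IH]; simpl; [apply phi1|].
now rewrite Hphi, IH by sub.
Qed.

Lemma phi_lcs n x : lcs N H n x -> lcs N (setT N) n (phi x).
Proof.
revert x. induction n as [|n IH]; [easy|].
enough (h : forall x, lcs N H (S n) x -> H x /\ lcs N (setT N) (S n) (phi x)) by apply h.
assert (hs : subgroup N (lcs N (setT N) (S n))) by now apply lcs_subgroup.
apply lcs_gen_ind.
- split; [split; [sub|rewrite phi1; sub]|split].
  + intros x y [hx lx] [hy ly]. rewrite Hphi by sub. split; sub.
  + intros x [hx lx]. rewrite phiV by sub. split; sub.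
- intros x y hx hy. assert (H y) by now apply (lcs_incl N H Hsub n).
  split; [sub|]. unfold gcomm. rewrite !Hphi, !phiV by sub.
  apply lcs_comm; [easy|]. now apply IH.
Qed.

Lemma H_root x : exists m, 0 < m /\ H (x ^ m).
Proof.
destruct Hfi as [l hl]. now apply (power_mem_of_cosets N H l).
Qed.

Lemma lcs_H_root n y : lcs N (setT N) n y -> exists m, 0 < m /\ lcs N H n (y ^ m).
Proof.
intros hy.
assert (hr : forall x, setT N x ->
  exists m l u, 0 < m /\ H l /\ lcs N (setT N) 1 u /\ x ^ m = l * u).
{ intros x _. destruct (H_root x) as [m [hm hx]]. exists m, (x ^ m), gone.
  repeat split; auto; [apply sub1; now apply lcs_subgroup|grp]. }
(* The depth [n + c] is at least [n], as [lcs_root] requires, and at least [c], so that the error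
   term is trivial. *)
destruct (lcs_root N (setT N) H Tsub Hsub (fun _ _ => I) hr n (n + c) ltac:(lia) y hy)
  as [m [l [u [hm [hl [hu e]]]]]].
exists m. split; [easy|]. rewrite e.
replace u with (gone : N); [now rewrite mulr1|].
symmetry. apply Nnil. apply (lcs_decr N _ Tsub c (S (n + c))); [lia|easy].
Qed.

(** From right to left, a power of [x] lies in [gamma_i(N)], and by [lcs_H_root] a further power
    lies in [gamma_i(H)]. *)
Lemma HisoE i x : Hiso N H i x <-> H x /\ Niso N i x.
Proof.
split.
- intros [hx [m [hm h]]]. split; [easy|]. split; [easy|]. exists m. split; [easy|].
  revert h. now apply lcs_mono.
- intros [hx [_ [m [hm h]]]]. split; [easy|].
  destruct (lcs_H_root _ _ h) as [k [hk h']]. exists (m * k)%nat.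
  split; [nia|]. now rewrite powM.
Qed.

Lemma Hiso_subgroup i : subgroup N (Hiso N H i).
Proof.
pose proof (Niso_subgroup N c Nnil i) as hs.
split; [|split].
- apply HisoE. split; sub.
- intros x y hx hy. apply HisoE in hx, hy. apply HisoE. split; apply subM; tauto.
- intros x hx. apply HisoE in hx. apply HisoE. split; apply subV; tauto.
Qed.

(** A power of [x] in [gamma_i(N)] says nothing about [phi]; [HisoE] replaces it by one in
    [gamma_i(H)], which [phi] sends into [gamma_i(N)]. *)
Lemma phi_Niso i x : H x -> Niso N i x -> Niso N i (phi x).
Proof.
intros hx hi. destruct (proj2 (HisoE i x) (conj hx hi)) as [_ [m [hm h]]].
split; [easy|]. exists m. split; [easy|]. rewrite <- phiX by easy. now apply phi_lcs.
Qed.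

(** * The twisted relation read as an equation in [N / N_i] *)

Section Levels.
Variables (i : nat) (Q : Group) (pi : N -> Q).
Hypothesis HQ : is_quotient (setT N) (Niso N i) Q pi.

Lemma twisted_rel_modE (L : N -> Prop) a b : (forall x, L x -> H x) ->
  (twisted_rel_mod N (Niso N i) L phi a b <->
   exists h, L h /\ pi a = pi h * pi b * (pi (phi h))^-1).
Proof.
intros LH. split; intros [h [hh e]]; exists h; split; auto.
- apply (quo_eq _ _ _ _ _ HQ) in e; try easy. rewrite <- e.
  now rewrite !(quoM _ _ _ _ _ HQ), phiV, (quoV _ _ _ _ _ Tsub HQ) by (auto; easy).
- apply (quo_eq _ _ _ _ _ HQ); try easy. rewrite e.
  now rewrite !(quoM _ _ _ _ _ HQ), phiV, (quoV _ _ _ _ _ Tsub HQ) by (auto; easy).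
Qed.

Lemma twisted_rel_mod_equiv (D L : N -> Prop) : subgroup N L -> (forall x, L x -> H x) ->
  equiv_on N D (twisted_rel_mod N (Niso N i) L phi).
Proof.
intros hL LH. split; [|split].
- intros x _. apply twisted_rel_modE; auto. exists gone. split; [sub|].
  rewrite phi1, (quo1 _ _ _ _ _ Tsub HQ). grp.
- intros x y _ _ e. apply twisted_rel_modE in e; auto. apply twisted_rel_modE; auto.
  destruct e as [h [hh e]]. exists h^-1. split; [sub|].
  rewrite phiV, !(quoV _ _ _ _ _ Tsub HQ), e by (auto; easy). grp.
- intros x y z _ _ _ e e'. apply twisted_rel_modE in e, e'; auto. apply twisted_rel_modE; auto.
  destruct e as [h [hh e]], e' as [h' [hh' e']]. exists (h * h'). split; [sub|].
  rewrite Hphi, !(quoM _ _ _ _ _ HQ), e, e' by (auto; easy). grp.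
Qed.

End Levels.

(* If [R(phi_i)] is finite, the image of [h |-> h phi(h)^-1] has finite index in
   [N_i / N_{i+1}], so by finite rank this map is injective. *)
Lemma fixed_point_free n r : reidemeister_induced N H phi (S n) = Some r ->
  forall h, H h -> Niso N (S n) h -> Niso N (S (S n)) (h * (phi h)^-1) -> Niso N (S (S n)) h.
Proof.
intros hr.
pose proof (Niso_subgroup N c Nnil (S n)) as As.
pose proof (Niso_subgroup N c Nnil (S (S n))) as Ms.
pose proof (Hiso_subgroup (S n)) as Ls.
set (A := Niso N (S n)) in *. set (M := Niso N (S (S n))) in *. set (L := Hiso N H (S n)) in *.
assert (LA : forall x, L x -> A x) by (intros x hx; now apply HisoE in hx).
assert (LH : forall x, L x -> H x) by (intros x hx; now apply HisoE in hx).
assert (Lphi : forall x, L x -> A (phi x)) by (intros x hx; apply phi_Niso; [auto|now apply LA]).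
assert (MA : forall x, M x -> A x) by (intros x; apply Niso_decr; lia).
destruct (quotient_exists N A M As Ms) as [Q [pi HQ]].
{ intros x y _. now apply Niso_normal. }
assert (Qc : forall x y : Q, x * y = y * x).
{ intros x y. destruct (quo_surj _ _ _ _ _ HQ x) as [a [ha <-]].
  destruct (quo_surj _ _ _ _ _ HQ y) as [b [hb <-]].
  apply comm_eq1. rewrite <- (quoR _ _ _ _ _ As HQ) by easy.
  apply (quo_ker _ _ _ _ _ As HQ); sub. now apply (Niso_comm N c Nnil). }
(* The graph of [h |-> h phi(h)^-1], defined on the image of [L] in [Q]. *)
set (R := fun p q => exists h, L h /\ p = pi h /\ q = pi h * (pi (phi h))^-1).
assert (RM : forall x y x' y', R x y -> R x' y' -> R (x * x') (y * y')).
{ intros ? ? ? ? [h [hh [-> ->]]] [h' [hh' [-> ->]]]. exists (h * h').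
  split; [sub|]. rewrite Hphi, !(quoM _ _ _ _ _ HQ) by auto. split; [easy|].
  rewrite mulACA, invM by easy. now rewrite (Qc (pi (phi h))^-1). }
assert (RV : forall x y, R x y -> R x^-1 y^-1).
{ intros ? ? [h [hh [-> ->]]]. exists h^-1. split; [sub|].
  rewrite phiV, !(quoV _ _ _ _ _ As HQ) by auto. split; [easy|].
  rewrite invM. apply Qc. }
assert (R1 : R gone gone).
{ exists gone. split; [sub|]. rewrite phi1, (quo1 _ _ _ _ _ As HQ). grp. }
destruct (lcs_finitely_generated N n Nfg) as [l [hl hgen]].
assert (inj : forall x, R x gone -> x = gone).
{ apply (partial_endo_injective Q Qc (map pi l)); auto.
  - intros q m hm e. destruct (quo_surj _ _ _ _ _ HQ q) as [x [hx <-]].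
    rewrite <- (quoX _ _ _ _ _ As HQ) in e by easy.
    apply (quo_ker _ _ _ _ _ As HQ) in e; sub.
    apply (quo_ker _ _ _ _ _ As HQ); auto. now apply (Niso_isolated N _ x m).
  - intros K [hK hKi] hlK q. destruct (quo_surj _ _ _ _ _ HQ q) as [x [hx <-]].
    (* Finite rank: a power of [x] lies in [gamma_{n+1}(N)], which [l] generates modulo the next
       term, and that term dies in [Q]. *)
    pose proof hx as [_ [m [hm hxm]]].
    apply (hKi _ m hm). rewrite <- (quoX _ _ _ _ _ As HQ) by easy.
    enough (h : A (x ^ m) /\ K (pi (x ^ m))) by apply h.
    apply (hgen (fun z => A z /\ K (pi z))); auto.
    + split; [split; [sub|rewrite (quo1 _ _ _ _ _ As HQ); sub]|split].
      * intros a b [ha ka] [hb kb]. rewrite (quoM _ _ _ _ _ HQ) by easy. split; sub.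
      * intros a [ha ka]. rewrite (quoV _ _ _ _ _ As HQ) by easy. split; sub.
    + intros z hz. assert (hMz : M z) by now apply Niso_lcs. split; auto.
      rewrite (proj2 (quo_ker _ _ _ _ _ As HQ z (MA z hMz)) hMz). sub.
    + intros y hy. split; [now apply Niso_lcs, hl|]. apply hlK. now apply in_map.
  - intros q [h [hh [e ->]]]. symmetry in e.
    assert (hM : M h) by (apply (quo_ker _ _ _ _ _ As HQ); auto).
    assert (hM' : M (phi h)) by (apply phi_Niso; [auto|exact hM]).
    apply (quo_ker _ _ _ _ _ As HQ) in hM'; auto.
    rewrite e, hM'. grp.
  - intros q.
    enough (h : exists m, 0 < m /\ exists p, R p (q ^ m))
      by (destruct h as [m [hm [p hp]]]; eauto).
    destruct (Niso_quotient N c Nnil (S (S n))) as [Q' [pi' HQ']].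
    apply num_classes_some in hr; [|now apply (twisted_rel_mod_equiv _ Q' pi' HQ')].
    destruct hr as [s [_ [hsA [_ hs]]]].
    (* Since [Q] is abelian, twisted classes are cosets of the image of [R]. There are finitely
       many, so every element has a power in that image. *)
    apply (power_mem_of_cosets Q (fun q => exists p, R p q) (map pi s)).
    + split; [eauto|split].
      * intros x y [p hp] [p' hp']. eauto.
      * intros x [p hp]. eauto.
    + intros k. destruct (quo_surj _ _ _ _ _ HQ (q ^ k)) as [a [ha <-]].
      destruct (hs a ha) as [x [hx [g [hg e]]]].
      change (L g) in hg. assert (A x) by now apply hsA.
      assert (A g) by auto. assert (A (phi g)) by auto.
      exists (pi x), (pi g * (pi (phi g))^-1). split; [now apply in_map|].
      split; [now exists (pi g), g|].
      rewrite phiV in e by auto.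
      apply (quo_eq _ _ _ _ _ HQ) in e; sub. rewrite <- e.
      rewrite !(quoM _ _ _ _ _ HQ), (quoV _ _ _ _ _ As HQ) by sub.
      rewrite (Qc (pi g) (pi x)). apply mulA_r. }
intros h hH hA hM.
assert (hL : L h) by now apply HisoE.
apply (quo_ker _ _ _ _ _ As HQ); auto. apply inj. exists h. split; [easy|].
split; [easy|].
rewrite <- (quoV _ _ _ _ _ As HQ), <- (quoM _ _ _ _ _ HQ) by (auto; apply subV; auto).
symmetry. apply (quo_ker _ _ _ _ _ As HQ); auto.
Qed.

(** Climb the series: once [h] lies in [N_{j+1}], so does [phi h], which is then central modulo
    [N_{j+2}]. There [b] cancels, and [fixed_point_free] moves [h] into [N_{j+2}]. *)
Lemma twisted_stabilizer k b h :
  (forall j, j < k -> exists r, reidemeister_induced N H phi (S j) = Some r) ->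
  H h -> Niso N (S k) (h * b * (phi h)^-1 * b^-1) -> Niso N (S k) h.
Proof.
intros hr hh hb. enough (h0 : forall j, j <= k -> Niso N (S j) h) by now apply h0.
induction j as [|j IH]; intros hj; [apply Niso_full|].
destruct (hr j hj) as [r er].
apply (fixed_point_free j r er h hh); [apply IH; lia|].
assert (hj' : Niso N (S j) h) by (apply IH; lia).
apply (Niso_decr N (S (S j))) in hb; [|lia].
destruct (Niso_quotient N c Nnil (S (S j))) as [Q [pi HQ]].
apply (quo_ker _ _ _ _ _ Tsub HQ) in hb; [|easy].
apply (quo_ker _ _ _ _ _ Tsub HQ); [easy|].
rewrite !(quoM _ _ _ _ _ HQ), !(quoV _ _ _ _ _ Tsub HQ) in hb by easy.
rewrite (quoM _ _ _ _ _ HQ), (quoV _ _ _ _ _ Tsub HQ) by easy.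
rewrite <- hb.
assert (hc : pi b * pi (phi h) = pi (phi h) * pi b).
{ symmetry. apply (Niso_central N c Nnil (S j)); auto. now apply phi_Niso. }
apply commute_inv in hc. rewrite !mulA_r. f_equal. rewrite gmulA, hc. grp.
Qed.

(** * Comparison of the class counts modulo consecutive terms [N_{k+1}] and [N_{k+2}] *)

Let rel k := twisted_rel_mod N (Niso N (S k)) H phi.

Lemma rel_equiv k : equiv_on N (setT N) (rel k).
Proof.
destruct (Niso_quotient N c Nnil (S k)) as [Q [pi HQ]].
now apply (twisted_rel_mod_equiv _ Q pi HQ).
Qed.

Lemma rel_decr k x y : rel (S k) x y -> rel k x y.
Proof.
intros [g [hg e]]. exists g. split; [easy|]. apply (Niso_decr N _ (S (S k))); auto.
Qed.

Lemma num_classes_step k n :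
  (forall j, j < k -> exists r, reidemeister_induced N H phi (S j) = Some r) ->
  num_classes N (setT N) (rel k) = Some n ->
  num_classes N (setT N) (rel (S k)) = omul (Some n) (reidemeister_induced N H phi (S k)).
Proof.
intros hr. destruct (Niso_quotient N c Nnil (S (S k))) as [Q [pi HQ]].
pose proof (Niso_subgroup N c Nnil (S k)) as As.
assert (LH : forall x, Hiso N H (S k) x -> H x) by (intros x hx; now apply HisoE in hx).
assert (hc : forall z q, Niso N (S k) z -> pi z * q = q * pi z)
  by (intros z q hz; now apply (Niso_central N c Nnil (S k))).
apply (num_classes_fibration N _ _ _ (rel k) gmul n).
- apply rel_equiv.
- apply rel_equiv.
- apply (twisted_rel_mod_equiv _ Q pi HQ); auto using Hiso_subgroup.
- apply rel_decr.
- intros b z hz. exists gone. split; [sub|]. rewrite inv1, phi1. grp.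
- intros a b [h [hh e]].
  (* Write [a = h b phi(h)^-1 m] with [m] in [N_{k+1}]. Conjugating [m] by [phi h] moves it next to
     [b], so that [a] is exactly [h (b z) phi(h)^-1]. *)
  exists ((phi h)^-1 * ((h * b * phi h^-1)^-1 * a) * phi h).
  split; [now apply Niso_normal|].
  exists h. split; [easy|]. rewrite !phiV by easy. grp.
  apply sub1. apply (Niso_subgroup N c Nnil).
- intros b z z' hz hz'. unfold rel.
  rewrite !(twisted_rel_modE _ Q pi HQ) by auto. split; intros [h [hh e]].
  + rewrite !(quoM _ _ _ _ _ HQ) in e by easy.
    assert (hN : Niso N (S k) h).
    (* As [z] and [z'] are central modulo [N_{k+2}], the equation turns [h b phi(h)^-1 b^-1] into
       [z z'^-1], an element of [N_{k+1}]. *)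
    { apply (twisted_stabilizer k b h hr hh).
      apply (sub_cancel_l _ _ (z * z'^-1)^-1); sub.
      apply (Niso_decr N _ (S (S k))); [lia|].
      apply (quo_eq _ _ _ _ _ HQ); try easy.
      rewrite !(quoM _ _ _ _ _ HQ), !(quoV _ _ _ _ _ Tsub HQ) by easy.
      assert (e' : pi z * pi b = pi z' * (pi h * pi b * (pi (phi h))^-1)).
      { rewrite (hc z), e, <- (hc z' (pi b)) by easy.
        rewrite (gmulA _ (pi h) (pi z')), <- (hc z' (pi h)) by easy. grp. }
      rewrite (hc z) by easy. apply (mul_cancel_l _ (pi z')).
      rewrite mulKV, gmulA, <- e'. grp. }
    exists h. split; [now apply HisoE|].
    (* Now [h] is central too, so [b] can be cancelled and the relation for [phi_{k+1}] between [z]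
       and [z'] remains. *)
    apply (mul_cancel_l _ (pi b)). rewrite e, !gmulA. now rewrite (hc h (pi b)).
  + exists h. split; auto. rewrite !(quoM _ _ _ _ _ HQ), e by easy.
    apply HisoE in hh. rewrite !gmulA. now rewrite (hc h (pi b)).
Qed.

Lemma num_classes_rel k :
  num_classes N (setT N) (rel k) = oprod (reidemeister_induced N H phi) k.
Proof.
induction k as [|k IH]; simpl.
- apply num_classes_some; [apply rel_equiv|]. exists (gone :: nil).
  repeat split.
  + apply separated_cons. split; [apply separated_nil|easy].
  + intros a _. exists gone. split; [now left|]. exists gone. split; [sub|apply Niso_full].
- destruct (oprod (reidemeister_induced N H phi) k) as [n|] eqn:e.
  + apply num_classes_step; auto. now apply (oprod_some _ k n).
  (* An infinite count persists because [rel (S k)] refines [rel k]. *)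
  + apply (num_classes_finer_none N _ (rel k)); auto using rel_equiv, rel_decr.
Qed.

Lemma rel_last : rel c = twisted_rel N H phi.
Proof.
apply functional_extensionality. intros a. apply functional_extensionality. intros b.
apply propositional_extensionality.
split; intros [g [hg e]]; exists g; split; auto.
(* [N_{c+1}] is trivial: its elements have a power in [gamma_{c+1}(N) = 1], and [N] is
   torsion-free. *)
- destruct e as [_ [m [hm e]]]. apply eq_of_mulV, (Ntf _ m hm). now apply Nnil.
- rewrite e, gmulV. apply sub1, (Niso_subgroup N c Nnil).
Qed.

End Reidemeister.

Theorem mainTheorem4 (N : Group) (c : nat) (H : N -> Prop) (phi : N -> N)
  (Nfg : finitely_generated N) (Ntf : torsion_free N)
  (Ncls : nilpotent_class N c)
  (Hsub : subgroup N H) (Hfi : finite_index N H)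
  (Hphi : is_hom_on N H phi) :
  reidemeister N H phi = oprod (fun i => reidemeister_induced N H phi i) c.
Proof.
destruct Ncls as [Nnil _].
unfold reidemeister. rewrite <- (rel_last N c H phi) by assumption.
now apply (num_classes_rel N c).
Qed.
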